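(* Let $A$ be a finite alphabet, $d\ge 1$, and let $u\colon\mathbb{N}\to A$ be a uniformly recurrent one-dimensional infinite word. Define the $d$-dimensional word $w\colon\mathbb{N}^d\to A$ by $w(\mathbf{i})=u(\gcd(\mathbf{i}))$ for all $\mathbf{i}\in\mathbb{N}^d$. Then $w$ is uniformly recurrent along all directions (URD).
   Context: $\mathbb{N}=\{0,1,2,\ldots\}$. For $\mathbf{i}=(i_1,\ldots,i_d)$, $\gcd(\mathbf{i})=\gcd(i_1,\ldots,i_d)$ (with $\gcd(0,\ldots,0)=0$). A one-dimensional word $u$ is uniformly recurrent if every finite factor of $u$ occurs in $u$ infinitely often with bounded gaps (equivalently, for every prefix $p$ there is $b$ such that every length-$b$ factor of $u$ contains $p$). A $d$-dimensional infinite word is a map $w\colon\mathbb{N}^d\to A$. For $\mathbf{s}=(s_1,\ldots,s_d)\in\mathbb{N}^d$ write $[\![\mathbf{0},\mathbf{s}-\mathbf{1}]\!]=\{0,\ldots,s_1-1\}\times\cdots\times\{0,\ldots,s_d-1\}$. A direction is a vector $\mathbf{q}=(q_1,\ldots,q_d)\in\mathbb{N}^d$ whose entries are coprime nonnegative integers. For a size $\mathbf{s}$ and a direction $\mathbf{q}$, let $w_{\mathbf{q},\mathbf{s}}\colon\mathbb{N}\to A^{[\![\mathbf{0},\mathbf{s}-\mathbf{1}]\!]}$ be the one-dimensional word (whose letters are blocks) defined by $(w_{\mathbf{q},\mathbf{s}}(\ell))(\mathbf{i})=w(\mathbf{i}+\ell\mathbf{q})$ for $\ell\in\mathbb{N}$,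 $\mathbf{i}\in[\![\mathbf{0},\mathbf{s}-\mathbf{1}]\!]$. The word $w$ is URD if for all $\mathbf{s}\in\mathbb{N}^d$ and all directions $\mathbf{q}$ there is $b\in\mathbb{N}$ such that every length-$b$ factor of $w_{\mathbf{q},\mathbf{s}}$ contains the letter $w_{\mathbf{q},\mathbf{s}}(0)$. *)

(* Defs.v *)
From mathcomp Require Import all_boot.

Set Implicit Arguments.
Unset Strict Implicit.
Unset Printing Implicit Defensive.

Definition factor (T : Type) (u : nat -> T) (m n : nat) : seq T :=
  [seq u (m + k) | k <- iota 0 n].

Definition occurs_at (T : Type) (u : nat -> T) (x : seq T) (n : nat) : Prop :=
  factor u n (size x) = x.

(* Every factor of u has an occurrence starting in each window of some fixed
   length b, i.e. it occurs infinitely often with gaps at most b. *)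
Definition uniformly_recurrent (T : Type) (u : nat -> T) : Prop :=
  forall x : seq T, (exists n, occurs_at u x n) ->
    exists b : nat, forall m : nat,
      exists2 n : nat, m <= n < m + b & occurs_at u x n.

(* The empty gcd is 0, so that the gcd of the null vector is 0. *)
Definition gcdv (d : nat) (i : {ffun 'I_d -> nat}) : nat :=
  \big[gcdn/0]_(k < d) i k.

Definition direction (d : nat) (q : {ffun 'I_d -> nat}) : Prop := gcdv q = 1.

(* The points of {0,..,s_1-1} x ... x {0,..,s_d-1}. *)
Definition box (d : nat) (s : {ffun 'I_d -> nat}) : finType :=
  {dffun forall k : 'I_d, 'I_(s k)}.

Definition dir_word (A : finType) (d : nat) (w : {ffun 'I_d -> nat} -> A)
    (q s : {ffun 'I_d -> nat}) (l : nat) : {ffun box s -> A} :=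
  [ffun i : box s => w [ffun k => i k + l * q k]].

Definition URD (A : finType) (d : nat) (w : {ffun 'I_d -> nat} -> A) : Prop :=
  forall s q : {ffun 'I_d -> nat}, direction q ->
    exists b : nat, forall m : nat,
      dir_word w q s 0 \in factor (dir_word w q s) m b.

(* Main.v *)
(** Moving along the direction [q], the value [gcd (i + l q)] behaves in one of
    two ways.  If [i] is parallel to [q], then [i = t q] with [t = gcd i], and
    [gcd (i + l q) = t + l].  Otherwise some minor [i_j q_k - i_k q_j] is
    nonzero; every common divisor of [i + l q] divides it, so
    [gcd (i + l q) = gcd i] as soon as the minor divides [l].  The block at the
    origin therefore reappears at every [l] which is a multiple of a suitable
    [N] and at which a long enough prefix of [u] occurs.

    That such [l] have bounded gaps is the crux.  Call a residue mod [N]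
    persistent if every prefix of [u] occurs at a position in this class.
    Persistent residues are closed under addition, hence under negation, and all
    occurrences of a long enough prefix sit at persistent residues.  So after any
    occurrence of a sufficiently long prefix, at residue [g] say, the given
    prefix occurs at a bounded offset congruent to [- g]. *)

Require Import Defs.
From mathcomp Require Import all_boot.
From Stdlib Require Import Classical.

Set Implicit Arguments.
Unset Strict Implicit.
Unset Printing Implicit Defensive.

Section PrefixOccurrences.

Variables (T : Type) (u : nat -> T).

Definition prefix_occurs (l n : nat) : Prop :=
  forall k, k < l -> u (n + k) = u k.

Definition prefix_residue (N l r : nat) : Prop :=
  exists2 n, n = r %[mod N] & prefix_occurs l n.

Lemma prefix_occursW l l' n :
  l <= l' -> prefix_occurs l' n -> prefix_occurs l n.
Proof. by move=> ll' occ k kl; apply: occ; apply: leq_trans ll'. Qed.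

Lemma prefix_occursD l m n :
  prefix_occurs (n + l) m -> prefix_occurs l n -> prefix_occurs l (m + n).
Proof.
by move=> occm occn k kl; rewrite -addnA occm ?occn // ltn_add2l.
Qed.

Lemma prefix_residueW N l l' r :
  l <= l' -> prefix_residue N l' r -> prefix_residue N l r.
Proof. by move=> ll' [n nr occ]; exists n => //; apply: prefix_occursW occ. Qed.

Lemma persistent_residueM N g :
  (forall l, prefix_residue N l g) -> forall k l, prefix_residue N l (k * g).
Proof.
move=> pg; elim=> [|k IHk] l; first by exists 0.
have [n nk occn] := IHk l; have [m mg occm] := pg (n + l).
exists (m + n); last exact: prefix_occursD.
by rewrite mulSn -modnDm mg nk modnDm.
Qed.

(** Induction on [M] takes a maximum over finitely many residues, which makes [L] uniform in [g]. *)
Lemma residue_compensation N l M : 0 < N ->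
  exists L, forall g, g < M -> prefix_residue N L g ->
    exists n, [/\ n < L, N %| g + n & prefix_occurs l n].
Proof.
move=> N0; elim: M => [|M [L HL]]; first by exists 0.
suff [L' HL'] : exists L', prefix_residue N L' M ->
    exists n, [/\ n < L', N %| M + n & prefix_occurs l n].
  exists (maxn L L') => g; rewrite ltnS leq_eqVlt => /predU1P[->|gM] res.
    have [n [nL' dvd occ]] := HL' (prefix_residueW (leq_maxr L L') res).
    by exists n; split=> //; rewrite leq_max nL' orbT.
  have [n [nL dvd occ]] := HL g gM (prefix_residueW (leq_maxl L L') res).
  by exists n; split=> //; rewrite leq_max nL.
(* If [M] is not persistent, a prefix length that fails at [M] makes the implication vacuous. *)
have [pM|/not_all_ex_not[L' nres]] := classic (forall l', prefix_residue N l' M);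
  last by exists L'.
(* [N.-1 * M] represents the class of [- M] modulo [N]. *)
have [n nM occ] := persistent_residueM pM N.-1 l.
exists n.+1 => _; exists n; split=> //.
by rewrite /dvdn -modnDmr nM modnDmr -mulSn prednK // modnMr.
Qed.

Lemma uniformly_recurrent_prefix l : uniformly_recurrent u ->
  exists b, forall m, exists2 n, m <= n < m + b & prefix_occurs l n.
Proof.
move=> /(_ (factor u 0 l)) []; first by exists 0; rewrite /occurs_at size_map size_iota.
move=> b Hb; exists b => m; have [n nm occ] := Hb m.
exists n => // k kl; move: occ; rewrite /occurs_at size_map size_iota.
move/(congr1 (fun s => nth (u 0) s k)).
by rewrite !(nth_map 0) ?size_iota // !nth_iota.
Qed.

Lemma uniformly_recurrent_prefix_dvdn l N : 0 < N -> uniformly_recurrent u ->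
  exists b, forall m,
    exists n, [/\ m <= n < m + b, N %| n & prefix_occurs l n].
Proof.
move=> N0 hu; have [L HL] := residue_compensation l N N0.
(* An occurrence of the [l]-prefix at an offset below [L] then lies inside the copied prefix. *)
have [b Hb] := uniformly_recurrent_prefix (L + l) hu.
exists (b + L) => m; have [n /andP[mn nb] occn] := Hb m.
have [|k [kL dvd occk]] := HL (n %% N) (ltn_pmod n N0).
  by exists n; rewrite ?modn_mod //; apply: prefix_occursW occn; apply: leq_addr.
exists (n + k); split.
- by rewrite (leq_trans mn) ?leq_addr //= addnA -addSn leq_add // ltnW.
- by move: dvd; rewrite /dvdn modnDml.
- apply: prefix_occursD occk; apply: prefix_occursW occn.
  by rewrite leq_add2r ltnW.
Qed.

End PrefixOccurrences.

Section GcdVector.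

Variable d : nat.
Implicit Types i q : {ffun 'I_d -> nat}.

Lemma dvdn_gcdvP e i : reflect (forall k, e %| i k) (e %| gcdv i).
Proof.
apply: (iffP idP) => [dvd k|dvd].
  by apply: dvdn_trans dvd _; rewrite /gcdv (bigD1 k) //= dvdn_gcdl.
by rewrite /gcdv; elim/big_ind: _ => // x y; rewrite dvdn_gcd => -> ->.
Qed.

Lemma gcdvM c i : gcdv [ffun k => c * i k] = c * gcdv i.
Proof.
rewrite /gcdv (big_morph (muln c) (muln_gcdr c) (muln0 c)).
by apply: eq_bigr => k _; rewrite ffunE.
Qed.

(** As [gcdv q = 1], [i j] is the gcd over [k] of [i j * q k = i k * q j], which is
    [q j * gcdv i]. *)
Lemma parallel_gcdv q i : direction q ->
  (forall j k, i j * q k = i k * q j) -> forall j, i j = gcdv i * q j.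
Proof.
move=> q1 par j; rewrite -[LHS]muln1 -q1 -gcdvM [RHS]mulnC -gcdvM.
by congr gcdv; apply/ffunP => k; rewrite !ffunE par mulnC.
Qed.

Lemma gcdv_shift_parallel q i l : direction q ->
  (forall j k, i j * q k = i k * q j) ->
  gcdv [ffun k => i k + l * q k] = l + gcdv i.
Proof.
move=> q1 par; rewrite -[RHS]muln1 -q1 -gcdvM; congr gcdv.
by apply/ffunP => k; rewrite !ffunE (parallel_gcdv q1 par) addnC mulnDl.
Qed.

Lemma gcdv_shift_minor q i l j k : i k * q j < i j * q k ->
  i j * q k - i k * q j %| l ->
  gcdv [ffun h => i h + l * q h] = gcdv i.
Proof.
move=> lt_minor dvd_l; apply/eqP; rewrite eqn_dvd; apply/andP; split.
  have dvd h : gcdv [ffun h => i h + l * q h] %| i h + l * q h.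
    by have /dvdn_gcdvP/(_ h) := dvdnn (gcdv [ffun h => i h + l * q h]); rewrite ffunE.
  apply/dvdn_gcdvP => h; rewrite -(dvdn_addl (n := l * q h)) //.
  apply/dvdn_mulr/(dvdn_trans _ dvd_l).
  (* The minor is invariant under the shift: the terms [l * q j * q k] cancel. *)
  have -> : i j * q k - i k * q j =
            (i j + l * q j) * q k - (i k + l * q k) * q j.
    by rewrite !mulnDl (mulnAC l (q k)) subnDr.
  by apply: dvdn_sub; apply: dvdn_mulr.
have dvd h : gcdv i %| i h by have /dvdn_gcdvP := dvdnn (gcdv i); apply.
apply/dvdn_gcdvP => h; rewrite ffunE dvdn_add //.
by apply/dvdn_mulr/(dvdn_trans _ dvd_l)/dvdn_sub; apply: dvdn_mulr.
Qed.

Lemma gcdv_shift q i l N : direction q ->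
  (forall j k, i k * q j < i j * q k -> i j * q k - i k * q j %| N) -> N %| l ->
  gcdv [ffun k => i k + l * q k] = gcdv i \/
  gcdv [ffun k => i k + l * q k] = l + gcdv i.
Proof.
move=> q1 minor_dvd dvd_l.
have [/existsP[j /existsP[k lt_minor]]|] :=
  boolP [exists j, exists k, i k * q j < i j * q k].
  by left; apply: (gcdv_shift_minor lt_minor); apply: dvdn_trans dvd_l; apply: minor_dvd.
rewrite negb_exists => /forallP par; right; apply: gcdv_shift_parallel => // j k.
have ge j' k' : i j' * q k' <= i k' * q j'.
  by have := par j'; rewrite negb_exists => /forallP/(_ k'); rewrite -leqNgt.
by apply/eqP; rewrite eqn_leq !ge.
Qed.

End GcdVector.

Theorem theorem4p4 (A : finType) (d : nat) (hd : 0 < d) (u : nat -> A)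
    (hu : uniformly_recurrent u) :
  URD (fun i : {ffun 'I_d -> nat} => u (gcdv i)).
Proof.
move=> s q q1.
pose vec (i : box s) : {ffun 'I_d -> nat} := [ffun k => i k : nat].
(* On the box, each positive minor is at most the product of the two maxima, hence divides its
   factorial. *)
pose N := ((\max_k s k) * (\max_k q k))`!.
(* [P] exceeds every gcd on the box, so an occurrence of the [P]-prefix at [n] gives
   [u (n + gcdv (vec i)) = u (gcdv (vec i))]. *)
pose P := (\max_(i : box s) gcdv (vec i)).+1.
have [b Hb] := uniformly_recurrent_prefix_dvdn P (fact_gt0 _ : 0 < N) hu.
exists b => m; have [n [/andP[mn nb] dvd_n occ]] := Hb m.
suff -> : dir_word (fun i => u (gcdv i)) q s 0 =
          dir_word (fun i => u (gcdv i)) q s n.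
  apply/mapP; exists (n - m); last by rewrite subnKC.
  by rewrite mem_iota /= add0n ltn_subLR.
apply/ffunP => i; rewrite !ffunE.
have shiftE l : [ffun k => i k + l * q k] = [ffun k => vec i k + l * q k].
  by apply/ffunP => k; rewrite !ffunE.
have -> : [ffun k => i k + 0 * q k] = vec i.
  by apply/ffunP => k; rewrite !ffunE addn0.
have minor_dvd j k : vec i k * q j < vec i j * q k ->
    vec i j * q k - vec i k * q j %| N.
  move=> lt_minor; apply: dvdn_fact; rewrite subn_gt0 lt_minor /=.
  apply: leq_trans (leq_subr _ _) _; apply: leq_mul; last exact: leq_bigmax.
  by rewrite ffunE; apply: leq_trans (ltnW (ltn_ord _)) _; apply: (leq_bigmax j).
rewrite shiftE; have [->|->] := gcdv_shift q1 minor_dvd dvd_n => //.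
by rewrite occ // ltnS; apply: (leq_bigmax i).
Qed.
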